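(* Let $G$ be a bipartite subcubic graph. If $G$ is a graph of stably matchable pairs, then $G[1]$ and $G[3]$ both have perfect matchings. Conversely, if $G[1]$, $G[2]$, and $G[3]$ all have perfect matchings, then $G$ is a graph of stably matchable pairs.
   Context: A graph is subcubic if every vertex has degree at most three. For a graph $G$ and natural number $i$, $G[i]$ denotes the subgraph of $G$ induced by its vertices of degree exactly $i$ (a graph with no vertices has the empty perfect matching). A stable matching instance consists of finite disjoint sets of students and residencies, where each student has a strict linear preference order on a subset of the residencies and each residency has a strict linear preference order on a subset of the students. A matching (set of student–residency pairs, each element in at most one pair) is stable if each of its pairs is mutually acceptable (each member appears in the other's list) and no mutually acceptable pair $(s,r)$ not in it has both $s$ unmatched or preferring $r$ to its partner and $r$ unmatched or preferring $s$ to its partner. The graph of stably matchable pairs of the instance is the bipartite graph whose vertices are all students and residencies and whose edges are the pairs occurring in at least one stable matching. A graph is a graph of stably matchable pairs if it is isomorphic to the graph of stably matchable pairs of some stable matching instance. *)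

(* Defs.v *)
From HB Require Import structures.
From mathcomp Require Import all_boot.

Set Implicit Arguments.
Unset Strict Implicit.
Unset Printing Implicit Defensive.

Record sgraph := SGraph {
  vertex :> finType;
  adj : rel vertex;
  adj_sym : symmetric adj;
  adj_irrefl : irreflexive adj }.

Definition degree (G : sgraph) (x : G) : nat := #|[set y : G | adj x y]|.

Definition subcubic (G : sgraph) : Prop := forall x : G, degree x <= 3.

Definition bipartite (G : sgraph) : Prop :=
  exists A : {set G}, forall x y : G, adj x y -> (x \in A) != (y \in A).

Definition isomorphic (G H : sgraph) : Prop :=
  exists2 f : G -> H, bijective f & forall x y : G, adj (f x) (f y) = adj x y.

Section Induced.
Variables (G : sgraph) (A : {set G}).

Definition induced_adj : rel {x : G | x \in A} :=
  fun u v => adj (val u) (val v).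

Lemma induced_adj_sym : symmetric induced_adj.
Proof. by move=> u v; apply: adj_sym. Qed.

Lemma induced_adj_irrefl : irreflexive induced_adj.
Proof. by move=> u; apply: adj_irrefl. Qed.

Definition induced : sgraph := SGraph induced_adj_sym induced_adj_irrefl.
End Induced.

(* G[i]: induced by the vertices whose degree in the whole of G is i. *)
Definition degree_subgraph (G : sgraph) (i : nat) : sgraph :=
  induced [set x : G | degree x == i].

(* The edge xy is represented by the two-element set [set x; y]; a perfect
   matching is a set of edges partitioning the vertices. *)
Definition perfect_matching (G : sgraph) (M : {set {set G}}) : Prop :=
  partition M [set: G] /\
  (forall E : {set G}, E \in M ->
     exists x y : G, adj x y /\ E = [set x; y]).

Definition has_perfect_matching (G : sgraph) : Prop :=
  exists M : {set {set G}}, perfect_matching M.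

(* A strict linear order on a subset of a finite set is given by the
   duplicate-free list of the elements of that subset, best first. *)
Record sm_instance := SMInstance {
  student : finType;
  residency : finType;
  student_list : student -> seq residency;
  residency_list : residency -> seq student;
  student_list_uniq : forall s, uniq (student_list s);
  residency_list_uniq : forall r, uniq (residency_list r) }.

Definition prefers (T : eqType) (l : seq T) (x y : T) : bool :=
  [&& x \in l, y \in l & index x l < index y l].

Section StableMatching.
Variable I : sm_instance.
Implicit Types (s : student I) (r : residency I).
Implicit Type M : {set student I * residency I}.

Definition acceptable s r : bool :=
  (r \in student_list s) && (s \in residency_list r).

Definition matching M : bool :=
  [forall p in M, forall q in M,
     ((p.1 == q.1) || (p.2 == q.2)) ==> (p == q)].

Definition student_wants M s r : bool :=
  [forall r', (s, r') \notin M] ||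
  [exists r', ((s, r') \in M) && prefers (student_list s) r r'].

Definition residency_wants M s r : bool :=
  [forall s', (s', r) \notin M] ||
  [exists s', ((s', r) \in M) && prefers (residency_list r) s s'].

Definition blocking M s r : bool :=
  [&& acceptable s r, (s, r) \notin M,
      student_wants M s r & residency_wants M s r].

Definition stable M : bool :=
  [&& matching M,
      [forall p in M, acceptable p.1 p.2] &
      [forall s, forall r, ~~ blocking M s r]].

Definition stably_matchable s r : bool :=
  [exists M : {set student I * residency I}, stable M && ((s, r) \in M)].

Definition smp_adj : rel (student I + residency I) := fun u v =>
  match u, v with
  | inl s, inr r => stably_matchable s r
  | inr r, inl s => stably_matchable s r
  | _, _ => false
  end.

Lemma smp_adj_sym : symmetric smp_adj.
Proof. by move=> [s|r] [s'|r']. Qed.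

Lemma smp_adj_irrefl : irreflexive smp_adj.
Proof. by case. Qed.

Definition smp_graph : sgraph := SGraph smp_adj_sym smp_adj_irrefl.
End StableMatching.

Definition is_smp_graph (G : sgraph) : Prop :=
  exists I : sm_instance, isomorphic G (smp_graph I).

(* Main.v *)
Require Import Defs.
From mathcomp Require Import all_boot zify.

(** Necessity: let [(s, r)] be a pair of a stable matching [M], and let [M'] be
another stable matching. If [s] prefers [M'] to [M] then [r] prefers [M] to
[M'], and conversely. So [r] is the best (worst) stable partner of [s] iff [s]
is the worst (best) stable partner of [r]. A stable partner which is both best
and worst makes an edge of [G[1]]; one which is neither is the middle one of
three, and these middle pairs match [G[3]].

Sufficiency: remove from [G] the matching of [G[3]] and the isolated edges.
What remains is 2-regular and bipartite, so its edges split into two perfect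
matchings [C] and [C']. Let each agent list its neighbours, students ranking
[C] first and [C'] last, residencies the other way round, with the removed
edges in the middle. Then [C], [C'] (completed by the isolated edges) and the
union of the three given matchings are stable, and together they cover [G]. *)

Set Implicit Arguments.
Unset Strict Implicit.
Unset Printing Implicit Defensive.

(** * Perfect matchings as fixed-point-free involutions *)

Lemma involution_perfect_matching (G : sgraph) (f : G -> G) :
  involutive f -> (forall x, adj x (f x)) -> has_perfect_matching G.
Proof.
move=> fK fadj.
have blockE x y : x \in [set y; f y] -> [set x; f x] = [set y; f y].
  by case/set2P=> ->; rewrite ?fK // setUC.
exists [set [set x; f x] | x : G]; split; last first.
  by move=> E /imsetP[x _ ->]; exists x, (f x).
apply/and3P; split.
- apply/eqP/setP=> x; rewrite inE; apply/bigcupP.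
  by exists [set x; f x]; [apply/imsetP; exists x | rewrite set21].
- apply/trivIsetP=> _ _ /imsetP[x _ ->] /imsetP[y _ ->]; apply: contraR.
  by case/pred0Pn=> z /andP[/blockE <- /blockE <-].
- by apply/imsetP=> -[x _ /setP/(_ x)]; rewrite inE set21.
Qed.

Lemma perfect_matching_involution (G : sgraph) :
  has_perfect_matching G ->
  exists2 f : G -> G, involutive f & forall x, adj x (f x).
Proof.
case=> M [Mpart Medge]; have [/eqP cov triv _] := and3P Mpart.
have xM x : x \in cover M by rewrite cov.
(* Adjacency rules out [x] itself, leaving the other element of its block; the default [x] is never
   reached. *)
pose f x := odflt x [pick y | adj x y && (y \in pblock M x)].
have fP x : adj x (f x) /\ pblock M x = [set x; f x].
  have xb : x \in pblock M x by rewrite mem_pblock.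
  have [a [b [ab Eb]]] := Medge _ (pblock_mem (xM x)).
  rewrite /f; case: pickP => [y /andP[xy yb]|/= none].
    split=> //; move: xb yb; rewrite Eb => /set2P[] xE /set2P[] yE.
    - by rewrite xE yE adj_irrefl in xy.
    - by rewrite xE yE.
    - by rewrite xE yE setUC.
    - by rewrite xE yE adj_irrefl in xy.
  move: xb; rewrite Eb => /set2P[] xE; [move: (none b)|move: (none a)].
    by rewrite Eb xE ab set22.
  by rewrite Eb xE adj_sym ab set21.
exists f => x; last by case: (fP x).
have [xf bx] := fP x; have [ffx bf] := fP (f x).
have: x \in pblock M (f x).
  by rewrite (same_pblock triv (y := x)) ?mem_pblock // bx set22.
rewrite bf => /set2P[] // xE; by rewrite -xE adj_irrefl in xf.
Qed.

(** [m] is unconstrained off degree [i], so the functions for different degrees can later be glued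
    into one. *)
Lemma degree_subgraph_perfect_matching (G : sgraph) (i : nat) :
  has_perfect_matching (degree_subgraph G i) <->
  exists m : G -> G, forall x, degree x = i ->
    [/\ adj x (m x), degree (m x) = i & m (m x) = x].
Proof.
split=> [/perfect_matching_involution[f fK fadj]|[m mP]].
  exists (fun x => if insub x is Some u then val (f u) else x) => x dx.
  have Dx : x \in [set y : G | degree y == i] by rewrite inE dx.
  rewrite (insubT (mem [set y : G | degree y == i]) Dx) valK fK; split=> //.
    exact: (fadj (Sub x Dx)).
  by have := valP (f (Sub x Dx)); rewrite inE => /eqP.
have mD x : x \in [set y : G | degree y == i] ->
    m x \in [set y : G | degree y == i].
  by rewrite !inE => /eqP/mP[_ -> _].
apply: (@involution_perfect_matching (degree_subgraph G i)
         (fun u => Sub (m (val u)) (mD _ (valP u)))).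
  move=> u; apply: val_inj => /=.
  by have := valP u; rewrite inE => /eqP/mP[].
by move=> u; have := valP u; rewrite inE => /eqP/mP[].
Qed.

(** * Necessity, from a ranking of the neighbours *)

(** Smaller ranks are better. The last two clauses are the contrapositive form of: [v] is best for
    [u] iff [u] is worst for [v]. *)
Definition balanced_ranking (G : sgraph) (rk : G -> G -> nat) : Prop :=
  [/\ forall u v w, adj u v -> adj u w -> rk u v = rk u w -> v = w,
      forall u v w, adj u v -> adj u w -> rk u w < rk u v ->
        exists2 x, adj v x & rk v u < rk v x
    & forall u v w, adj u v -> adj u w -> rk u v < rk u w ->
        exists2 x, adj v x & rk v x < rk v u].

Lemma balanced_ranking_iso (G H : sgraph) (rk : H -> H -> nat) :
  isomorphic G H -> balanced_ranking rk ->
  exists rk' : G -> G -> nat, balanced_ranking rk'.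
Proof.
case=> f [g fK gK] fadj [inj lo hi].
exists (fun x y => rk (f x) (f y)); split=> u v w.
- by rewrite -!fadj => uv uw /inj-/(_ uv uw)/(can_inj fK).
- rewrite -!fadj => uv uw /lo-/(_ uv uw)[x vx lt].
  by exists (g x); rewrite -?fadj gK.
- rewrite -!fadj => uv uw /hi-/(_ uv uw)[x vx lt].
  by exists (g x); rewrite -?fadj gK.
Qed.

(** The only neighbour [y] of a vertex [x] of degree 1 is both best and worst for it, so [x] is both
    for [y], and injectivity of the ranks leaves [y] no other neighbour. *)
Lemma balanced_ranking_matching1 (G : sgraph) (rk : G -> G -> nat) :
  balanced_ranking rk -> has_perfect_matching (degree_subgraph G 1).
Proof.
move=> [inj lo hi]; apply/degree_subgraph_perfect_matching.
exists (fun x => odflt x [pick y | adj x y]) => x /eqP/cards1P[y /setP Nx].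
have adjx z : adj x z = (z == y) by have := Nx z; rewrite !inE.
have Ny z : adj y z = (z == x).
  apply/idP/eqP=> [yz|->]; last by rewrite adj_sym adjx.
  have yx : adj y x by rewrite adj_sym adjx.
  case: (ltngtP (rk y x) (rk y z)) => [lt|gt|/inj-> //].
    have [w] := hi _ _ _ yx yz lt; by rewrite adjx => /eqP->; rewrite ltnn.
  have [w] := lo _ _ _ yx yz gt; by rewrite adjx => /eqP->; rewrite ltnn.
have pickE (u v : G) : adj u =1 pred1 v -> odflt u [pick w | adj u w] = v.
  move=> uE; case: pickP => [w|/(_ v)]; rewrite uE /=; first by move/eqP.
  by rewrite eqxx.
rewrite (pickE x y adjx) (pickE y x Ny) adjx eqxx; split=> //.
by apply/eqP/cards1P; exists x; apply/setP=> z; rewrite !inE Ny.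
Qed.

Lemma balanced_ranking_matching3 (G : sgraph) (rk : G -> G -> nat) :
  subcubic G -> balanced_ranking rk ->
  has_perfect_matching (degree_subgraph G 3).
Proof.
move=> cubG [inj lo hi]; apply/degree_subgraph_perfect_matching.
(* The neighbour [v] is neither best nor worst for [u]; balance makes this relation symmetric. *)
pose mid u v := [&& adj u v, [exists w, adj u w && (rk u w < rk u v)]
                           & [exists w, adj u w && (rk u v < rk u w)]].
have mid_sym u v : mid u v -> mid v u.
  case/and3P=> uv /existsP[w /andP[uw lw]] /existsP[x /andP[ux lx]].
  apply/and3P; split; first by rewrite adj_sym.
    by have [y vy ly] := hi _ _ _ uv ux lx; apply/existsP; exists y; rewrite vy.
  by have [y vy ly] := lo _ _ _ uv uw lw; apply/existsP; exists y; rewrite vy.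
have mid_nbr u v : mid u v -> exists w x, [/\ rk u w < rk u v, rk u v < rk u x
      & [set z | adj u z] = [set w; v; x]].
  case/and3P=> uv /existsP[w /andP[uw lw]] /existsP[x /andP[ux lx]].
  (* The ranks of [w], [v], [x] are distinct, and subcubicity allows no fourth neighbour. *)
  exists w, x; split=> //; apply/esym/eqP; rewrite eqEcard.
  apply/andP; split; first by apply/subsetP=> z; rewrite !inE -orbA => /or3P[]/eqP->.
  apply: leq_trans (cubG u) _.
  have wv : w != v by apply: contraTneq lw => ->; rewrite ltnn.
  have wx : w != x by apply: contraTneq lw => ->; rewrite -leqNgt ltnW.
  have vx : v != x by apply: contraTneq lx => ->; rewrite ltnn.
  by rewrite setUC cardsU1 cards2 !inE negb_or ![x == _]eq_sym wx vx wv.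
have mid_deg u v : mid u v -> degree u = 3.
  move=> uv; have [w [x [lw lx E]]] := mid_nbr u v uv.
  rewrite /degree E setUC cardsU1 cards2 !inE negb_or.
  have wv : w != v by apply: contraTneq lw => ->; rewrite ltnn.
  have wx : w != x by apply: contraTneq lw => ->; rewrite -leqNgt ltnW.
  have vx : v != x by apply: contraTneq lx => ->; rewrite ltnn.
  by rewrite ![x == _]eq_sym wx vx wv.
have mid_fun u v v' : mid u v -> mid u v' -> v = v'.
  move=> uv uv'; have [w [x [lw lx E]]] := mid_nbr u v uv.
  have [w' [x' [lw' lx' E']]] := mid_nbr u v' uv'.
  have v3 : v' \in [set w; v; x] by rewrite -E inE; case/and3P: uv'.
  have w3 : w' \in [set w; v; x] by rewrite -E E' !inE eqxx.
  have x3 : x' \in [set w; v; x] by rewrite -E E' !inE eqxx !orbT.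
  move: v3 w3 x3 lw' lx'; rewrite !inE -!orbA.
  by do 3![case/or3P=> /eqP->]=> //; lia.
have mid_ex u : degree u = 3 -> exists v, mid u v.
  (* The second entry of the sorted list is the middle neighbour; injectivity of the ranks makes the
     inequalities strict. *)
  move=> du; pose s := sort (relpre (rk u) leq) (enum [set z | adj u z]).
  have ss : size s = 3 by rewrite size_sort -cardE.
  have us : uniq s by rewrite sort_uniq enum_uniq.
  have sst : sorted (relpre (rk u) leq) s.
    by apply: sort_sorted => a b; apply: leq_total.
  have ms z : (z \in s) = adj u z by rewrite mem_sort mem_enum inE.
  case: s ss us sst ms => [|a [|b [|c [|]]]] //= _.
  rewrite !inE negb_or andbT => /andP[/andP[ab ac] bc] /and3P[lab lbc _] ms.
  have ua : adj u a by rewrite -ms !inE eqxx.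
  have ub : adj u b by rewrite -ms !inE eqxx orbT.
  have uc : adj u c by rewrite -ms !inE eqxx !orbT.
  exists b; apply/and3P; split=> //; apply/existsP.
    exists a; rewrite ua ltn_neqAle lab andbT.
    by apply: contra ab => /eqP/inj->.
  exists c; rewrite uc ltn_neqAle lbc andbT.
  by apply: contra bc => /eqP/inj->.
pose m x := odflt x [pick y | mid x y].
have mP x : degree x = 3 -> mid x (m x).
  by case/mid_ex=> v xv; rewrite /m; case: pickP => // /(_ v); rewrite xv.
exists m => x /mP xm; have mx := mid_sym _ _ xm; split.
- by case/and3P: xm.
- exact: mid_deg mx.
- exact: mid_fun (mP _ (mid_deg _ _ mx)) mx.
Qed.

(* Stable matchings as involutions, whose fixed points are the unmatched
   agents; [rk u u] is the rank of being unmatched, worse than any acceptable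
   partner. *)
Section StableInvolutions.
Variables (V : finType) (acc : rel V) (rk : V -> V -> nat).
Hypothesis acc_sym : symmetric acc.
Hypothesis rk_acc : forall u v, acc u v -> rk u v < rk u u.
Hypothesis rk_inj :
  forall u v w, acc u v -> acc u w -> rk u v = rk u w -> v = w.

Definition stable_involution (f : V -> V) : Prop :=
  [/\ involutive f,
      forall u, f u != u -> acc u (f u)
    & forall u v, acc u v -> (rk u (f u) <= rk u v) || (rk v (f v) <= rk v u)].

Implicit Types f g : V -> V.

(** Since [u] would gain by leaving [f u] for [g u], stability of [f] forces [g u] to like its state
    under [f] at least as much as [u]; a tie would give [f u = g u]. *)
Lemma stable_involution_worse f g u :
  stable_involution f -> stable_involution g ->
  rk u (g u) < rk u (f u) -> rk (g u) (f (g u)) < rk (g u) u.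
Proof.
move=> [fK facc fst] [gK gacc gst] lt.
have rk_f : rk u (f u) <= rk u u.
  by have [->|/facc/rk_acc/ltnW] := eqVneq (f u) u.
have gu : g u != u.
  by apply: contraTneq lt => ->; rewrite -leqNgt.
have au := gacc u gu; set v := g u in gu au lt *.
have av : acc v u by rewrite acc_sym.
have := fst u v au; rewrite leqNgt lt /= leq_eqVlt => /orP[/eqP eqr|//].
have fv : f v != v.
  by apply: contraTneq (rk_acc av) => fvv; rewrite -eqr fvv ltnn.
have fvu := rk_inj (facc v fv) av eqr.
by move: lt; rewrite -fvu fK ltnn.
Qed.

(* The agents preferring [g] to [f] and those preferring [f] to [g] are
   exchanged by both [f] and [g]: [g] maps the former into the latter and [f]
   the latter into the former, and both maps are injective. *)
Lemma stable_involution_better f g u :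
  stable_involution f -> stable_involution g ->
  rk u (g u) < rk u (f u) ->
  rk (f u) u < rk (f u) (g (f u)) /\ g (f u) != f u.
Proof.
move=> fS gS lt; have [fK _ _] := fS; have [gK _ _] := gS.
pose P := [set x | rk x (g x) < rk x (f x)].
pose Q := [set x | rk x (f x) < rk x (g x)].
have gPQ : g @: P \subset Q.
  apply/subsetP=> _ /imsetP[x xP ->]; move: xP; rewrite !inE => xP.
  by rewrite gK; apply: stable_involution_worse.
have fQP : f @: Q \subset P.
  apply/subsetP=> _ /imsetP[x xQ ->]; move: xQ; rewrite !inE => xQ.
  by rewrite fK; apply: stable_involution_worse.
have cPQ : #|P| <= #|Q|.
  by rewrite -(card_imset (mem P) (can_inj gK)) subset_leq_card.
have cQP : #|Q| <= #|P|.
  by rewrite -(card_imset (mem Q) (can_inj fK)) subset_leq_card.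
have gE : g @: P = Q.
  by apply/eqP; rewrite eqEcard gPQ card_imset ?cQP //; apply: can_inj gK.
have fE : f @: Q = P.
  by apply/eqP; rewrite eqEcard fQP card_imset ?cPQ //; apply: can_inj fK.
have: u \in P by rewrite inE.
rewrite -fE => /imsetP[v vQ ->]; rewrite fK; split; first by rewrite inE in vQ.
(* A fixed point of [g] in [Q] would be its own preimage in [P], but [P] and [Q] are disjoint. *)
move: (vQ); rewrite -gE => /imsetP[x xP vE].
rewrite vE gK -vE; apply: contraTneq xP => ->.
by move: vQ; rewrite !inE -leqNgt => /ltnW.
Qed.
End StableInvolutions.

(** * Stable matchings of an instance as stable involutions *)

Section Instance.
Variable I : sm_instance.
Let V : finType := (student I + residency I)%type.

Definition agent_acceptable : rel V := fun u v =>
  match u, v with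
  | inl s, inr r => acceptable s r
  | inr r, inl s => acceptable s r
  | _, _ => false
  end.

Definition agent_rank (u v : V) : nat :=
  match u, v with
  | inl s, inr r => index r (student_list s)
  | inr r, inl s => index s (residency_list r)
  | inl s, inl _ => size (student_list s)
  | inr r, inr _ => size (residency_list r)
  end.

Definition agent_mate (M : {set student I * residency I}) (u : V) : V :=
  match u with
  | inl s => if [pick r | (s, r) \in M] is Some r then inr r else inl s
  | inr r => if [pick s | (s, r) \in M] is Some s then inl s else inr r
  end.

Lemma agent_acceptable_sym : symmetric agent_acceptable.
Proof. by move=> [s|r] [s'|r']. Qed.

Lemma agent_rank_acceptable u v :
  agent_acceptable u v -> agent_rank u v < agent_rank u u.
Proof.
by case: u v => [s|r] [s'|r'] //= /andP[]; rewrite index_mem.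
Qed.

Lemma agent_rank_inj u v w :
  agent_acceptable u v -> agent_acceptable u w ->
  agent_rank u v = agent_rank u w -> v = w.
Proof.
case: u v w => [s|r] [s1|r1] [s2|r2] //= /andP[a b] /andP[c d].
  by move/index_inj=> -> //.
by move/index_inj=> -> //.
Qed.

Lemma agent_mateP (M : {set student I * residency I}) : stable M ->
  stable_involution agent_acceptable agent_rank (agent_mate M) /\
  forall s r, (s, r) \in M -> agent_mate M (inl s) = inr r.
Proof.
case/and3P=> /forallP mM /forallP aM /forallP bM.
have uniqM p q : p \in M -> q \in M -> (p.1 == q.1) || (p.2 == q.2) -> p = q.
  move=> pM qM e; have /forallP/(_ q) := implyP (mM p) pM.
  by rewrite qM e /= => /eqP.
have mateS s r : (s, r) \in M -> agent_mate M (inl s) = inr r.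
  move=> srM /=; case: pickP => [r' sr'M|/(_ r)]; last by rewrite srM.
  by have [->] := uniqM _ _ sr'M srM (introT orP (or_introl (eqxx s))).
have mateR s r : (s, r) \in M -> agent_mate M (inr r) = inl s.
  move=> srM /=; case: pickP => [s' sr'M|/(_ s)]; last by rewrite srM.
  by have [->] := uniqM _ _ sr'M srM (introT orP (or_intror (eqxx r))).
have accM s r : (s, r) \in M -> acceptable s r.
  by move=> srM; have := implyP (aM (s, r)) srM.
split=> //; split.
- case=> [s|r]; rewrite {2}/agent_mate; case: pickP => [z zM|none].
  + exact: mateR.
  + by rewrite /=; case: pickP => // z; rewrite none.
  + exact: mateS.
  + by rewrite /=; case: pickP => // z; rewrite none.
- by case=> [s|r] /=; case: pickP => [z /accM|_ /eqP].
- have st s r : acceptable s r ->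
      (agent_rank (inl s) (agent_mate M (inl s)) <= agent_rank (inl s) (inr r))
   || (agent_rank (inr r) (agent_mate M (inr r)) <= agent_rank (inr r) (inl s)).
    move=> sr; have := forallP (bM s) r; rewrite /blocking sr /=.
    have [srM|_ /=] := boolP ((s, r) \in M).
      by rewrite -/(agent_mate M (inl s)) (mateS _ _ srM) leqnn.
    have [srS srR] := andP sr.
    rewrite negb_and !negb_or !negb_forall !negb_exists.
    case/orP=> /andP[/existsP[z]]; rewrite negbK => zM /forallP/(_ z);
      rewrite zM /prefers /=; have /andP[zS zR] := accM _ _ zM.
      rewrite srS zS -leqNgt -/(agent_mate M (inl s)) (mateS _ _ zM) /=.
      by move=> ->.
    rewrite srR zR -leqNgt -/(agent_mate M (inr r)) (mateR _ _ zM) /=.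
    by move=> ->; rewrite orbT.
  case=> [s|r] [s'|r'] //; first exact: st.
  by move=> rs; rewrite orbC; apply: st.
Qed.

(** For edges [u v] from [M] and [u w] from [N], the required neighbour of [v] is its mate in [N].
    When [u] prefers [w], only the counting argument shows that [v] is matched in [N]. *)
Lemma smp_graph_balanced_ranking :
  balanced_ranking (G := smp_graph I) agent_rank.
Proof.
have adjP (u v : V) : reflect
    (exists2 M, stable M & agent_mate M u = v /\ v != u) (smp_adj u v).
  apply: (iffP idP) => [|[M stM [<-]]].
    case: u v => [s|r] [s'|r'] // /existsP[M /andP[stM srM]]; exists M => //;
      have [[K _ _] E] := agent_mateP stM; first by rewrite (E _ _ srM).
    by rewrite -(E _ _ srM) K (E _ _ srM).
  case: u => [s|r] /=; case: pickP => [z zM _|_ /eqP//];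
    by apply/existsP; exists M; rewrite stM.
have matchP (u v : V) : smp_adj u v -> agent_acceptable u v /\
    exists2 M, stable M & agent_mate M u = v.
  case/adjP=> M stM [<- ne]; split; last by exists M.
  by have [[_ ac _] _] := agent_mateP stM; apply: ac.
have [sym acc] := (agent_acceptable_sym, agent_rank_acceptable).
split=> u v w /matchP[uv [M stM fu]] /matchP[uw [N stN gu]].
- exact: agent_rank_inj.
- have [fS gS] := ((agent_mateP stM).1, (agent_mateP stN).1).
  rewrite -fu -gu => lt.
  have [lt' ne] := stable_involution_better sym acc agent_rank_inj fS gS lt.
  by exists (agent_mate N (agent_mate M u)) => //; apply/adjP; exists N.
- have [fS gS] := ((agent_mateP stM).1, (agent_mateP stN).1).
  rewrite -fu -gu => lt.
  have lt' := stable_involution_worse sym acc agent_rank_inj gS fS lt.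
  exists (agent_mate N (agent_mate M u)) => //; apply/adjP; exists N => //.
  (* Being unmatched ranks below the acceptable [u], so [v], which prefers [N], is matched there. *)
  split=> //; apply: contraTneq lt' => ->; rewrite -leqNgt ltnW // acc //.
  by rewrite sym fu.
Qed.
End Instance.

(** * Alternating edge colourings of bipartite 2-regular graphs *)

Section TwoInvolutions.
Variables (T : finType) (s t : T -> T) (D : pred T).
Hypotheses (sK : involutive s) (tK : involutive t).
Hypotheses (sD : forall x, D x -> D (s x)) (tD : forall x, D x -> D (t x)).
Hypotheses (s_neq : forall x, D x -> s x != x).
Hypotheses (t_neq : forall x, D x -> t x != x).

Let f x := t (s x).

Let f_inj : injective f.
Proof. by move=> x y /(inv_inj tK)/(inv_inj sK). Qed.

Let f_sym x y : fconnect f x y = fconnect f y x.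
Proof. exact: fconnect_sym. Qed.

Let f_iter k x : iter k f (s (iter k f x)) = s x.
Proof.
elim: k x => // k IH x; rewrite iterSr {1}iterS.
by rewrite /f !(sK, tK) IH.
Qed.

(* [s] conjugates [f := t \o s] to its inverse. If [s x = f^k x], the point
   halfway along this path is fixed by [s] (k even) or by [t] (k odd). *)
Let not_connect_s x : D x -> ~~ fconnect f x (s x).
Proof.
move=> Dx; apply/negP=> /iter_findex; move: (findex _ _ _) => k E.
have DI j : D (iter j f x) by elim: j => //= j IH; apply/tD/sD.
have half j i : iter (j + i) f x = s x -> iter i f x = s (iter j f x).
  have fj_inj : injective (iter j f) by elim: j => //= j IH y z /f_inj/IH.
  by move=> jk; apply: fj_inj; rewrite f_iter -iterD.
have := odd_double_half k; case: (odd k) => /= kE.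
  have /half/= e : iter (k./2 + k./2.+1) f x = s x by rewrite -E -[in RHS]kE; congr iter; lia.
  have := t_neq (sD (DI k./2)); by rewrite -/(f _) e eqxx.
have /half/esym e : iter (k./2 + k./2) f x = s x by rewrite -E -[in RHS]kE; congr iter; lia.
by have := s_neq (DI k./2); rewrite e eqxx.
Qed.

(** On [D], [s] exchanges two distinct cycles of [f], and [t x = f (s x)] lies on the cycle of
    [s x]. Comparing the ranks of the two cycles tells them apart. *)
Lemma two_involutions_coloring :
  exists c : pred T, forall x, D x -> (c (s x) = ~~ c x) /\ (c (t x) = ~~ c x).
Proof.
pose rk x : nat := enum_rank (froot f x).
have rk_connect x y : fconnect f x y -> rk x = rk y.
  by move=> xy; rewrite /rk (rootP f_sym xy).
have rkt x : rk (t x) = rk (s x).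
  by apply/esym/rk_connect; rewrite -{2}(sK x) fconnect1.
have rkst x : rk (s (t x)) = rk x.
  by apply: rk_connect; rewrite -{2}[x]tK -{2}[t x]sK fconnect1.
exists (fun x => rk x < rk (s x)) => x Dx; rewrite rkst rkt sK.
suff: rk x != rk (s x) by case: ltngtP.
apply: contra (not_connect_s Dx) => /eqP/val_inj/enum_rank_inj/eqP.
by rewrite root_connect.
Qed.
End TwoInvolutions.

(* The two involutions exchange, at one end of an oriented edge, the two edges
   incident to that end. *)
Lemma two_regular_coloring (T : finType) (A : {set T}) (H : rel T) :
  symmetric H -> (forall x y, H x y -> (x \in A) != (y \in A)) ->
  (forall x y, H x y -> #|[set z | H x z]| = 2) ->
  exists C : rel T, (forall x y, H x y -> C x y = C y x) /\
    (forall x y z, H x y -> H x z -> y != z -> C x z = ~~ C x y).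
Proof.
move=> symH bipH degH.
pose o x y := odflt y [pick z | H x z && (z != y)].
have oP x y : H x y -> H x (o x y) /\ o x y != y.
  move=> xy; rewrite /o; case: pickP => [z /andP[]//|none].
  suff: [set z | H x z] \subset [set y].
    by move/subset_leq_card; rewrite (degH _ _ xy) cards1.
  apply/subsetP=> z; rewrite !inE => xz; apply: contraFT (none z).
  by rewrite xz.
have oE x y z : H x y -> H x z -> z != y -> o x y = z.
  move=> xy xz zy; have [xo oy] := oP x y xy; apply: contraTeq isT => oz.
  have: [set z; y; o x y] \subset [set w | H x w].
    by apply/subsetP=> w; rewrite !inE -orbA => /or3P[]/eqP->.
  move/subset_leq_card; rewrite (degH _ _ xy) setUC cardsU1 cards2 !inE.
  by rewrite negb_or oz oy zy.
have oK x y : H x y -> o x (o x y) = y.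
  by move=> xy; have [xo oy] := oP x y xy; apply: oE; rewrite // eq_sym.
(* The identity outside [H] makes [s] and [t] involutions on all pairs. *)
pose s p := if H p.1 p.2 then (p.1, o p.1 p.2) else p.
pose t p := if H p.1 p.2 then (o p.2 p.1, p.2) else p.
have tH x y : H x y -> H (o y x) y.
  by rewrite symH => /oP[]; rewrite symH.
have [||||||c cP] := @two_involutions_coloring _ s t (fun p => H p.1 p.2).
- move=> [x y]; case xy: (H x y); rewrite /s /= xy /= ?xy //.
  by rewrite (oP _ _ xy).1 oK.
- move=> [x y]; case xy: (H x y); rewrite /t /= xy /= ?xy //.
  by rewrite tH // oK // symH.
- by move=> [x y] /= xy; rewrite /s /= xy /= (oP _ _ xy).1.
- by move=> [x y] /= xy; rewrite /t /= xy /= tH.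
- move=> [x y] /= xy; rewrite /s /= xy xpair_eqE eqxx /=.
  by case: (oP _ _ xy).
- move=> [x y] /= xy; rewrite /t /= xy xpair_eqE eqxx andbT.
  by rewrite symH in xy; case: (oP _ _ xy).
(* [c] colours oriented edges; reading each edge from its end in [A] makes the colour symmetric. *)
exists (fun x y => if x \in A then c (x, y) else c (y, x)); split=> x y.
  by move/bipH; case: (x \in A); case: (y \in A).
move=> z xy xz yz; have Ez : o x y = z by apply: oE; rewrite // eq_sym.
case: ifP => _; first by have [<- _] := cP (x, y) xy; rewrite /s /= xy Ez.
have yx : H y x by rewrite symH.
by have [_ <-] := cP (y, x) yx; rewrite /t /= yx Ez.
Qed.

(** * Instances built from a ranking of the neighbours *)

Section PreferenceList.
Variables (T : finType) (P : pred T) (rk : T -> nat).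

Definition preference_list : seq T := sort (relpre rk leq) (enum P).

Lemma mem_preference_list x : (x \in preference_list) = P x.
Proof. by rewrite mem_sort mem_enum. Qed.

Lemma preference_list_uniq : uniq preference_list.
Proof. by rewrite sort_uniq enum_uniq. Qed.

(** The inequality is weak because sorting breaks ties of [rk] arbitrarily. *)
Lemma prefers_preference_list x y :
  prefers preference_list x y -> rk x <= rk y.
Proof.
case/and3P=> xl yl /ltnW.
have tr : transitive (relpre rk leq) by move=> a b c; apply: leq_trans.
have st : sorted (relpre rk leq) preference_list.
  by apply: sort_sorted => a b; apply: leq_total.
exact: (sorted_leq_index tr (fun a => leqnn (rk a)) st).
Qed.
End PreferenceList.

(* Agents are the vertices, [A] being the students, and list their neighbours by
   increasing [rk]; [F] selects stable perfect matchings, given as involutions. *)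
Lemma smp_graph_of_ranking (G : sgraph) (A : {set G}) (rk : G -> G -> nat)
    (F : (G -> G) -> Prop) :
  (forall x y, adj x y -> (x \in A) != (y \in A)) ->
  (forall p x y, F p -> adj x y -> adj x (p x) /\ p (p x) = x) ->
  (forall p x y, F p -> adj x y -> x \in A -> y != p x ->
     rk x y <= rk x (p x) -> rk y x <= rk y (p y) -> False) ->
  (forall x y, adj x y -> exists2 p, F p & p x = y) ->
  is_smp_graph G.
Proof.
move=> bipA Fp stF covF.
pose S : finType := {x : G | x \in A}; pose R : finType := {x : G | x \notin A}.
pose sl (x : S) : seq R :=
  preference_list (fun y : R => adj (val x) (val y)) (fun y => rk (val x) (val y)).
pose rl (x : R) : seq S :=
  preference_list (fun y : S => adj (val x) (val y)) (fun y => rk (val x) (val y)).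
pose I := @SMInstance S R sl rl (fun _ => preference_list_uniq _ _)
  (fun _ => preference_list_uniq _ _).
have accE (x : S) (y : R) : @acceptable I x y = adj (val x) (val y).
  by rewrite /acceptable /= !mem_preference_list [adj (val y) _]adj_sym andbb.
(* Pairs must be edges, since [F] does not control [p] on isolated vertices. *)
have stP p : F p -> stable (I := I)
    [set q : S * R | adj (val q.1) (val q.2) && (p (val q.1) == val q.2)].
  move=> pF; apply/and3P; split.
  - apply/forallP=> -[x y]; apply/implyP; rewrite inE => /andP[/= xy /eqP pxy].
    apply/forallP=> -[z w]; apply/implyP; rewrite inE => /andP[/= zw /eqP pzw].
    apply/implyP=> e; apply/eqP; case/orP: e => /eqP /= e.
      by rewrite e; congr (_, _); apply: val_inj; rewrite /= -pxy -pzw e.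
    rewrite e; congr (_, _); apply: val_inj => /=.
    rewrite -(Fp _ _ _ pF xy).2 -(Fp _ _ _ pF zw).2.
    by rewrite pxy pzw e.
  - by apply/forallP=> -[x y]; apply/implyP; rewrite inE accE => /andP[].
  apply/forallP=> x; apply/forallP=> y; apply/negP=> /and4P[].
  rewrite accE inE /= => xy; rewrite xy /= eq_sym => ne xw yw.
  have yx : adj (val y) (val x) by rewrite adj_sym.
  have [[xp pp] [yp ppy]] := (Fp _ _ _ pF xy, Fp _ _ _ pF yx).
  have pxA : p (val x) \notin A.
    by have := bipA _ _ xp; rewrite (valP x); case: (_ \in A).
  have pyA : p (val y) \in A.
    by have := bipA _ _ yp; rewrite (negPf (valP y)); case: (_ \in A).
  (* Both ends are matched, so wanting each other amounts to the two weak rank inequalities that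
     [stF] excludes. *)
  apply: (stF p _ _ pF xy (valP x) ne).
    case/orP: xw => [/forallP/(_ (exist (fun z => z \notin A) _ pxA))|].
      by rewrite inE /= xp eqxx.
    case/existsP=> z; rewrite inE /= => /andP[/andP[_ /eqP->]].
    exact: (prefers_preference_list (rk := fun v : R => rk (val x) (val v))).
  case/orP: yw => [/forallP/(_ (exist (fun z => z \in A) _ pyA))|].
    by rewrite inE /= adj_sym yp ppy eqxx.
  case/existsP=> z; rewrite inE /= => /andP[/andP[zy /eqP pz]].
  have -> : p (val y) = val z by rewrite /= -pz (Fp _ _ _ pF zy).2.
  exact: (prefers_preference_list (rk := fun v : S => rk (val y) (val v))).
have adjE (x : S) (y : R) : @stably_matchable I x y = adj (val x) (val y).
  apply/existsP/idP=> [[M /andP[/and3P[_ /forallP aM _] xyM]]|xy].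
    by rewrite -accE; have := implyP (aM (x, y)) xyM.
  have [p pF pxy] := covF _ _ xy; eexists.
  apply/andP; split; first exact: (stP p pF).
  by rewrite inE /= xy pxy eqxx.
pose g (u : smp_graph I) : G :=
  match u with inl x => val x | inr y => val y end.
have gadj u v : adj (g u) (g v) = adj u v.
  case: u v => [x|x] [y|y] /=; rewrite ?adjE // 1?adj_sym //.
    by apply/negP=> /bipA; rewrite (valP x) (valP y).
  by apply/negP=> /bipA; rewrite (negPf (valP x)) (negPf (valP y)).
have g_inj : injective g.
  case=> [x|x] [y|y] /= e; try by congr (_ _); apply: val_inj.
    by have /negP[] := valP y; rewrite /= -e; apply: valP.
  by have /negP[] := valP x; rewrite /= e; apply: valP.
have g_surj x : exists u, g u == x.
  by have [xA|xA] := boolP (x \in A); [exists (inl (Sub x xA))|exists (inr (Sub x xA))];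
    rewrite /=.
pose f x := xchoose (g_surj x).
have fK : cancel f g by move=> x; apply/eqP/(xchooseP (g_surj x)).
exists I, f; last by move=> x y; rewrite -gadj !fK.
by exists g => // u; apply: g_inj; rewrite fK.
Qed.

(** * Sufficiency: three stable matchings that cover all edges *)

Lemma perfect_matchings_smp_graph (G : sgraph) (m : G -> G) :
  bipartite G -> subcubic G ->
  (forall x y, adj x y -> [/\ adj x (m x), degree (m x) = degree x & m (m x) = x]) ->
  is_smp_graph G.
Proof.
move=> [A bipA] cubG mP.
have deg_gt0 (x y : G) : adj x y -> 0 < degree x.
  by move=> xy; apply/card_gt0P; exists y; rewrite inE.
have deg1 x y : degree x = 1 -> adj x y -> y = m x.
  move=> dx xy; have [xm _ _] := mP _ _ xy.
  have/eqP/cards1P[z /setP E] := dx.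
  by move: (E y) (E (m x)); rewrite !inE xy xm => /esym/eqP-> /esym/eqP.
(* the 2-regular graph left by removing the middle and the isolated edges *)
pose H x y := [&& adj x y, degree x != 1 & (degree x == 3) ==> (y != m x)].
have symH : symmetric H.
  suff impH x y : H x y -> H y x by move=> x y; apply/idP/idP; apply: impH.
  case/and3P=> xy dx dm; have yx : adj y x by rewrite adj_sym.
  have [[xm dmx mmx] [ym dmy mmy]] := (mP _ _ xy, mP _ _ yx).
  apply/and3P; split=> //.
    by apply: contra dx => /eqP dy; rewrite (deg1 _ _ dy yx) dmy dy.
  apply/implyP=> /eqP dy; apply: contraL dm => /eqP xE.
  by rewrite xE dmy dy mmy /= eqxx.
have bipH x y : H x y -> (x \in A) != (y \in A) by case/and3P=> /bipA.
have degH x y : H x y -> #|[set z | H x z]| = 2.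
  case/and3P=> xy dx dm; have [xm dmx mmx] := mP _ _ xy.
  have d0 := deg_gt0 _ _ xy; have d3 := cubG x.
  have [dx3|dx3] := eqVneq (degree x) 3.
    have -> : [set z | H x z] = [set z | adj x z] :\ m x.
      by apply/setP=> z; rewrite !inE /H dx3 /= andbC.
    have := cardsD1 (m x) [set z | adj x z].
    by rewrite inE xm -/(degree x) dx3 => -[].
  have -> : [set z | H x z] = [set z | adj x z].
    by apply/setP=> z; rewrite !inE /H dx (negPf dx3) /= andbT.
  by rewrite -/(degree x); lia.
have [C [Csym Calt]] := two_regular_coloring symH bipH degH.
have nH x y : adj x y -> ~~ H x y -> y = m x.
  move=> xy; rewrite /H xy /= negb_and negbK negb_imply negbK.
  case/orP=> [/eqP dx|/andP[_ /eqP]//]; exact: deg1 dx xy.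
(* Colour class [b] of [H], completed by the isolated edges. *)
pose K b x y := if H x y then C x y == b else (degree x == 1) && adj x y.
have K_adj b x y : K b x y -> adj x y.
  by rewrite /K; case: ifP => [/and3P[]|_ /andP[]].
have H_deg x y : H x y -> (degree x == 1) = false by case/and3P=> _ /negPf.
have Ksym b x y : K b x y -> K b y x.
  rewrite /K [H y x]symH; case: ifP => [/Csym->//|_ /andP[/eqP dx xy]].
  have [_ dmx _] := mP _ _ xy.
  by rewrite (deg1 _ _ dx xy) dmx dx -(deg1 _ _ dx xy) adj_sym xy.
have Kfun b x y z : K b x y -> K b x z -> y = z.
  move=> xy xz; have [ay az] := (K_adj _ _ _ xy, K_adj _ _ _ xz).
  move: xy xz; rewrite /K; case: ifPn => [Hy Cy|_ /andP[/eqP dx _] _].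
    case: ifPn => [Hz|_ /andP[]]; last by rewrite (H_deg _ _ Hy).
    have [//|yz] := eqVneq y z; rewrite (Calt _ _ _ Hy Hz yz) (eqP Cy).
    by case: (b).
  by rewrite (deg1 _ _ dx ay) (deg1 _ _ dx az).
have Kex b x y : adj x y -> exists z, K b x z.
  move=> xy; have [dx|dx] := eqVneq (degree x) 1.
    by exists y; rewrite /K /H xy dx.
  have [z Hz] : exists z, H x z.
    have [Hy|/nH-/(_ xy) yE] := boolP (H x y); first by exists y.
    apply/existsP; apply: contraNT dx; rewrite negb_exists => /forallP noH.
    have : [set z | adj x z] \subset [set y].
      (* Every edge at [x] outside [H] leads to [m x], which is [y]; so [x] would have degree 1. *)
      apply/subsetP=> z; rewrite !inE => /nH-/(_ (noH z))->; exact/eqP.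
    move/subset_leq_card; rewrite cards1 -/(degree x).
    by have := deg_gt0 _ _ xy; lia.
  have [Cz|Cz] := eqVneq (C x z) b; first by exists z; rewrite /K Hz Cz eqxx.
  have : 1 < #|[set z | H x z]| by rewrite (degH _ _ Hz).
  case/card_gt1P=> w [w' []]; rewrite !inE => Hw Hw' ww'.
  have [Cw|Cw] := eqVneq (C x w) b; first by exists w; rewrite /K Hw Cw eqxx.
  exists w'; rewrite /K Hw' (Calt _ _ _ Hw Hw' ww').
  by case: (C x w) (b) Cw => -[].
pose q b x := odflt x [pick y | K b x y].
have qP b x y : adj x y -> K b x (q b x).
  case/(Kex b)=> z Kz; rewrite /q.
  by case: pickP => // /(_ z); rewrite Kz.
(* Vertices of [A] put colour [true] first, the others colour [false]; removed edges get the middle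
   rank 1. *)
pose rk x y := if H x y then (if C x y == (x \in A) then 0 else 2) else 1.
(* Two neighbours cannot share the last rank 2, because the two [H]-edges at [x] have opposite
   colours. *)
have rk_top x y z : H x y -> y != z -> rk x y <= rk x z ->
    C x y = (x \in A).
  rewrite /rk => Hy yz; rewrite Hy; case: eqVneq => // Cy.
  case: ifP => // Hz; rewrite (Calt _ _ _ Hy Hz yz).
  by case: (C x y) (x \in A) Cy => -[].
have invF p x y : p = m \/ (exists b, p = q b) -> adj x y ->
    adj x (p x) /\ p (p x) = x.
  move=> [->|[b ->]] xy; first by have [] := mP _ _ xy.
  have Kx := qP b x y xy; have xq := K_adj _ _ _ Kx; split=> //.
  by apply: (Kfun b (q b x)); [apply: (qP b _ x); rewrite adj_sym|apply: Ksym].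
apply: (@smp_graph_of_ranking G A rk _ bipA invF) => [p x y pF xy xA ne|x y xy].
  have yx : adj y x by rewrite adj_sym.
  have yA : (y \in A) = false by have := bipA _ _ xy; rewrite xA; case: (_ \in A).
  have ne' : x != p y.
    by apply: contra ne => /eqP->; rewrite (invF _ _ _ pF yx).2.
  (* A blocking [H]-edge would be a first choice at both ends, but the two sides rank the colours
     oppositely. *)
  have [Hxy|nHxy] := boolP (H x y).
    have Hyx : H y x by rewrite symH.
    move=> /(rk_top _ _ _ Hxy ne) Cxy /(rk_top _ _ _ Hyx ne').
    by rewrite -Csym // Cxy xA yA.
  have nHyx : ~~ H y x by rewrite symH.
  have yE := nH _ _ xy nHxy; have xE := nH _ _ yx nHyx.
  case: pF ne ne' => [->|[b ->]] ne ne'; first by rewrite -yE eqxx in ne.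
  (* A middle-ranked edge can block [q b] only where [b] is the last choice, which holds on one side
     only. *)
  have side u v : adj u v -> ~~ H u v -> v != q b u ->
      rk u v <= rk u (q b u) -> b != (u \in A).
    move=> uv nHuv vq; rewrite /rk (negPf nHuv).
    have := qP b u v uv; rewrite /K; case: ifP => [_ /eqP->|_].
      by case: eqP.
    case/andP=> /eqP du uq.
    by rewrite (deg1 _ _ du uv) (deg1 _ _ du uq) eqxx in vq.
  move=> /(side _ _ xy nHxy ne) bx /(side _ _ yx nHyx ne').
  by move: bx; rewrite xA yA; case: (b).
have [Hxy|/nH-/(_ xy)->] := boolP (H x y); last by exists m => //; left.
exists (q (C x y)); first by right; exists (C x y).
by apply: (Kfun (C x y) x); [apply: qP xy|rewrite /K Hxy].
Qed.

Theorem theorem7 (G : sgraph) (bipG : bipartite G) (subG : subcubic G) :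
  (is_smp_graph G ->
     has_perfect_matching (degree_subgraph G 1) /\
     has_perfect_matching (degree_subgraph G 3)) /\
  (has_perfect_matching (degree_subgraph G 1) ->
   has_perfect_matching (degree_subgraph G 2) ->
   has_perfect_matching (degree_subgraph G 3) ->
   is_smp_graph G).
Proof.
split=> [[I isoG]|].
  have [rk bal] := balanced_ranking_iso isoG (smp_graph_balanced_ranking I).
  split; first exact: balanced_ranking_matching1 bal.
  exact: balanced_ranking_matching3 bal.
move=> /degree_subgraph_perfect_matching[m1 m1P].
move=> /degree_subgraph_perfect_matching[m2 m2P].
move=> /degree_subgraph_perfect_matching[m3 m3P].
(* Each matching preserves degree, so [m (m x)] stays in the same branch; degree 0 falls into the
   default branch, irrelevant on edges. *)
pose m x := match degree x with 1 => m1 x | 2 => m2 x | _ => m3 x end.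
apply: (perfect_matchings_smp_graph (m := m)) => // x y xy.
have: 0 < degree x by apply/card_gt0P; exists y; rewrite inE.
have := subG x; case dx: (degree x) => [|[|[|[|]]]] // _ _.
- by have [xm dm mm] := m1P _ dx; have -> : m x = m1 x; rewrite /m ?dx ?dm.
- by have [xm dm mm] := m2P _ dx; have -> : m x = m2 x; rewrite /m ?dx ?dm.
- by have [xm dm mm] := m3P _ dx; have -> : m x = m3 x; rewrite /m ?dx ?dm.
Qed.
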